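(* Let $\varphi:K\to L$ be a continuous surjection between compact spaces. Assume $D$ is a set induced by a retractional skeleton in $K$ and put $B=\varphi(D)$. Then the following conditions are equivalent: (i) $B$ is induced by a retractional skeleton in $L$. (ii) $\varphi^*\mathcal{C}(L)=\{f\circ\varphi: f\in\mathcal{C}(L)\}$ is $\tau_p(D)$-closed in $\mathcal{C}(K)$. (iii) $L=\beta B$ and $B$ is a Fréchet–Urysohn space. (iv) $L=\beta B$ and $\varphi\upharpoonright_D$ is a quotient mapping of $D$ onto $B$.
   Context: All topological spaces are Hausdorff. $\mathcal{C}(K)$ is the space of continuous real functions on $K$. For a dense set $D\subset K$, $\tau_p(D)$ is the topology on $\mathcal{C}(K)$ of pointwise convergence on $D$. Subsets of $K$ and $L$ carry the subspace topology. $\beta B$ is the Stone–Čech compactification of $B$; ''$L=\beta B$'' means that $L$, together with the inclusion $B\subset L$, is the Stone–Čech compactification of $B$. A space $T$ is Fréchet–Urysohn if for every $A\subset T$ and $x\in\overline{A}$ there is a sequence in $A$ converging to $x$. A partially ordered set $\Gamma$ is up-directed if any two elements have an upper bound in $\Gamma$, and $\sigma$-complete if every increasing sequence in $\Gamma$ has a supremum in $\Gamma$. A retractional skeleton in a compact space $K$ is a family $\{r_s\}_{s\in\Gamma}$ of (continuous) retractions of $K$ into itself, indexed by an up-directed $\sigma$-complete partially ordered set $\Gamma$, such that: (i) $r_s[K]$ is metrizable for each $s$; (ii) $x=\lim_{s\in\Gamma}r_s(x)$ for every $x\in K$; (iii) $s\le t\Rightarrow r_s=r_s\circ r_t=r_t\circ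 r_s$; (iv) if $s_1<s_2<\cdots$ in $\Gamma$ and $t=\sup_n s_n$, then $r_t(x)=\lim_n r_{s_n}(x)$ for every $x\in K$. The set induced by this retractional skeleton is $\bigcup_{s\in\Gamma}r_s[K]$ (it is dense in $K$). *)

(* Defs.v *)
From mathcomp Require Import all_boot all_order all_algebra.
From mathcomp Require Import all_classical all_reals all_analysis.

Set Implicit Arguments.
Unset Strict Implicit.
Unset Printing Implicit Defensive.

Import Order.TTheory GRing.Theory Num.Theory.
Import numFieldNormedType.Exports.

Local Open Scope classical_set_scope.

(* Subsets [A : set T] used as spaces are the types [set_type A], which
   MathComp-Analysis equips with the subspace topology. *)

(* Homeomorphic to a metric space. *)
Definition metrizable (R : realType) (T : topologicalType) : Prop :=
  exists (M : metricType R) (h : T -> M) (g : M -> T),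
    [/\ cancel h g, cancel g h, continuous h & continuous g].

Definition frechet_urysohn (T : topologicalType) : Prop :=
  forall (A : set T) (x : T), closure A x ->
    exists2 u : nat -> T, (forall n, A (u n)) & u @ \oo --> x.

Definition quotient_mapping (X Y : topologicalType) (f : X -> Y) : Prop :=
  range f = [set: Y] /\ forall U : set Y, open U <-> open (f @^-1` U).

(* "[L] is the Stone-Cech compactification of [B]": a compactification of [B]
   with the universal property; extensions are unique because [B] is dense. *)
Record is_stone_cech (L : topologicalType) (B : set L) : Prop := {
  stone_cech_compact : compact [set: L];
  stone_cech_hausdorff : hausdorff_space L;
  stone_cech_dense : dense B;
  stone_cech_extend : forall (Z : topologicalType) (f : B -> Z),
    compact [set: Z] -> hausdorff_space Z -> continuous f ->
    exists F : L -> Z, continuous F /\ sigL B F = f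
}.

Definition up_directed d (G : porderType d) : Prop :=
  forall s t : G, exists u : G, (s <= u)%O /\ (t <= u)%O.

Definition sigma_complete d (G : porderType d) : Prop :=
  forall s : nat -> G, nondecreasing_seq s ->
    exists t : G, supremums (range s) t.

(* The net [f] indexed by [G] converges to [l] iff [f @ up_tails G --> l]. *)
Definition up_tails d (G : porderType d) : set_system G :=
  filter_from [set: G] (fun s => [set t | (s <= t)%O]).

Arguments up_tails {d} G _.

Record retractional_skeleton (R : realType) (K : topologicalType) d
    (G : porderType d) (r : G -> K -> K) : Prop := {
  rskel_directed : up_directed G;
  rskel_complete : sigma_complete G;
  rskel_continuous : forall s, continuous (r s);
  rskel_retraction : forall s, r s \o r s = r s;
  rskel_metrizable : forall s, metrizable R (range (r s));
  rskel_cvg : forall x, r^~ x @ up_tails G --> x;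
  rskel_le : forall s t, (s <= t)%O ->
    r s = r s \o r t /\ r s = r t \o r s;
  rskel_sup : forall (s : nat -> G) (t : G),
    (forall n, (s n < s n.+1)%O) -> supremums (range s) t ->
    forall x, (fun n => r (s n) x) @ \oo --> r t x
}.

Definition induced_by_skeleton (R : realType) (K : topologicalType)
    (D : set K) : Prop :=
  exists d (G : porderType d) (r : G -> K -> K),
    retractional_skeleton R r /\ D = \bigcup_s range (r s).

(* The space of continuous functions [K -> R] with the topology of pointwise
   convergence on [D]. *)
Definition tau_p (R : realType) (K : topologicalType) (D : set K) :
    topologicalType :=
  initial_topology
    (fun f : continuousType K R => (sigL D f : {ptws D -> R})).

Definition pullback (R : realType) (K L : topologicalType) (phi : K -> L) :
    set (continuousType K R) :=
  [set g | exists f : continuousType L R, g = f \o phi :> (K -> R)].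

Arguments pullback R {K L} phi _.

(* Main.v *)
Require Import Defs.
From HB Require Import structures.
From mathcomp Require Import all_boot all_order all_algebra.
From mathcomp Require Import all_classical all_reals all_analysis.
From mathcomp Require Import lra.

Set Implicit Arguments.
Unset Strict Implicit.
Unset Printing Implicit Defensive.

Import Order.TTheory GRing.Theory Num.Theory.
Import numFieldNormedType.Exports.

Local Open Scope classical_set_scope.

(** Write F_s for the range of r_s. If s_n increases to t, then F_t is the
    inverse limit of the compact metrizable spaces F_(s_n), because r_(s_n)
    converges pointwise to r_t. Hence the preimages under r_(s_n) of the
    members of countable bases of the F_(s_n) form a countable network of r_t,
    and this network is already visible at the stages s_n. Since countably
    many points of D lie in a single F_s, one can go back and forth: list the
    network available at s_n, choose points of D witnessing countably many
    existential statements about its members, and choose s_(n+1) with these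
    witnesses in F_(s_(n+1)). The supremum t then reflects these statements,
    and r_t fixes all the witnesses. This is lemma [skel_reflection]; it plays
    the role of a countable elementary submodel, and the arguments below rest
    on it.

    - If x lies in the closure of a subset A of D, then r_t x lies in the
      closure of the part of A inside some metrizable F_t ([induced_closure]).
      For x in D this gives the Frechet-Urysohn property of D; applied to two
      sets at once it shows that sets with disjoint closures in D have
      disjoint closures in K, so that maps from D to compact spaces extend
      ([dense_extension]) and K = beta D. Applied to the skeleton of L, this
      is (i) => (iii).

    - (iii) => (iv): D is countably compact, so the restriction of phi to D
      maps closed sets to sequentially closed ones, which are closed in the
      Frechet-Urysohn space B.

    - (iv) => (ii): the fibres of phi on D constrain every function in the
      closure of the pullback, so such a function descends to B and then
      extends to beta B.

    - (ii) => (i): any tau_p(D)-closed set P of functions is stable under f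
      |-> f o r_t for cofinally many t ([skel_preserves_closed]). Indeed, a
      basic neighbourhood of f o r_t missing P can be described with the
      network of r_t, so by reflection there is another one whose finitely
      many base points are fixed by r_t; f itself belongs to it, and hence not
      to P. When P is the pullback of C(L), stability implies that r_t respects
      the fibres of phi, so r_t induces a retraction of L. These t form a
      cofinal set closed under suprema of sequences, and the induced
      retractions form a skeleton of L ([compatible_skeleton]); their ranges
      are metrizable because countable bases pass to Hausdorff images of
      compact spaces. *)

(** * Point-set preliminaries *)

Lemma countable_enum (T : Type) (x0 : T) (A : set T) :
  countable A -> exists f : nat -> T, forall x, A x -> exists n, f n = x.
Proof.
move=> /countable_injP[g ginj].
have hx n : exists x, forall y, A y -> g y = n -> x = y.
  have [[x [Ax gx]]|no] := pselect (exists x, A x /\ g x = n).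
    by exists x => y Ay gy; apply: ginj; rewrite ?inE// gx gy.
  by exists x0 => y Ay gy; case: no; exists y.
have [f hf] := choice hx.
by exists f => x Ax; exists (g x); exact: hf.
Qed.

Lemma nbhs_sub_open (T : topologicalType) (x : T) (U : set T) :
  nbhs x U -> exists V, [/\ open V, V x & V `<=` U].
Proof. by rewrite nbhsE => -[V [oV Vx] VU]; exists V. Qed.

Lemma closureP (T : topologicalType) (A : set T) (x : T) :
  closure A x <-> forall U, open U -> U x -> exists2 y, A y & U y.
Proof.
split=> [cAx U oU Ux|h U /nbhs_sub_open[V [oV Vx VU]]].
  by have [|y [Ay Uy]] := cAx U; [exact: open_nbhs_nbhs|exists y].
by have [y Ay Vy] := h _ oV Vx; exists y; split=> //; exact: VU.
Qed.

Lemma hausdorff_separate (T : topologicalType) (x y : T) :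
  hausdorff_space T -> x <> y ->
  exists U V, [/\ open U, open V, U x, V y & U `&` V = set0].
Proof.
rewrite open_hausdorff => hT /eqP/hT[[U V]] /= [/set_mem Ux /set_mem Vy].
by move=> [oU oV /eqP UV]; exists U, V.
Qed.

Lemma compact_shrink (Z : topologicalType) (z : Z) (U : set Z) :
  compact [set: Z] -> hausdorff_space Z -> open U -> U z ->
  exists W, [/\ open W, W z & closure W `<=` U].
Proof.
move=> cZ hZ oU Uz.
have [B /nbhs_sub_open[W [oW Wz WB]] BU] : filter_from (nbhs z) closure U.
  apply: (@compact_regular _ _ setT) => //; first exact: filterT.
  exact: open_nbhs_nbhs.
by exists W; split=> //; apply: subset_trans BU; exact: closureS.
Qed.

Lemma hausdorff_closed1 (T : topologicalType) (x : T) :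
  hausdorff_space T -> closed [set x].
Proof. by move=> hT; exact/accessible_closed_set1/hausdorff_accessible. Qed.

Lemma image_compact (S T : topologicalType) (f : S -> T) (F : set S) :
  continuous f -> compact F -> compact (f @` F).
Proof. by move=> cf; apply: continuous_compact; exact: continuous_subspaceT. Qed.

Lemma image_closed (S T : topologicalType) (f : S -> T) (F : set S) :
  hausdorff_space T -> continuous f -> compact F -> closed (f @` F).
Proof. by move=> hT cf cF; apply: compact_closed => //; exact: image_compact. Qed.

Lemma compact_set_type (T : topologicalType) (F : set T) :
  compact F -> compact [set: F].
Proof.
move=> cF G PG _.
have FG : G (set_val @^-1` F) by apply: filterE => x; exact: set_valP.
have [p [Fp clp]] := cF (set_val @ G) _ FG.
exists (SigSub (mem_set Fp)); split=> // A B GA [_ [[C oC <-] /= Cp] CB].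
have [||q [[x Ax <-] Cq]] := clp (set_val @` A) C.
- by apply: (@filterS _ G _ A) => // x Ax; exists x.
- by apply: open_nbhs_nbhs.
- by exists x; split => //; apply: CB.
Qed.

Lemma set_type_hausdorff (T : topologicalType) (F : set T) :
  hausdorff_space T -> hausdorff_space F.
Proof.
move=> hT p q pq; apply: contrapT => npq.
have npq' : set_val p <> set_val q by move=> /val_inj.
have [A [B [oA oB Ap Bq AB]]] := hausdorff_separate hT npq'.
have [||z [Az Bz]] := pq (set_val @^-1` A) (set_val @^-1` B).
- by apply: open_nbhs_nbhs; split=> //; exists A.
- by apply: open_nbhs_nbhs; split=> //; exists B.
by have : (A `&` B) (set_val z) by []; rewrite AB.
Qed.

Lemma closure_set_val (X : topologicalType) (D : set X) (A : set D) (x : D) :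
  closure A x -> closure (set_val @` A) (set_val x).
Proof.
move=> /closureP cA; apply/closureP => U oU Ux.
have [|y Ay Uy] := cA (set_val @^-1` U) _ Ux; first by exists U.
by exists (set_val y) => //; exists y.
Qed.

Lemma cvg_set_val (I : Type) (X : topologicalType) (D : set X)
    (F : set_system I) (u : I -> D) (x : D) : Filter F ->
  (fun i => set_val (u i)) @ F --> set_val x -> u @ F --> x.
Proof.
move=> FF ux B [_ [[C oC <-] /= Cx] CB].
have /ux : nbhs (set_val x) C by exact: open_nbhs_nbhs.
by rewrite !nbhs_simpl/=; apply: filterS => i /CB.
Qed.

(** * Countable bases and metrizability *)

(** The subspace F is second countable; its base is cut out by open sets of
    the ambient space, which is convenient for taking preimages and images. *)
Definition has_base_on (T : topologicalType) (F : set T) (V : nat -> set T) :=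
  (forall n, open (V n)) /\
  forall x U, F x -> open U -> U x -> exists2 n, V n x & V n `&` F `<=` U.

Lemma metrizable_base (R : realType) (T : topologicalType) (F : set T) :
  compact F -> metrizable R F -> exists V, has_base_on F V.
Proof.
move=> cF [M [h [g [hK gK ch cg]]]].
have [[p Fp]|F0] := pselect (exists p, F p); last first.
  by exists (fun=> set0); split=> [n|x U Fx]; [exact: open0|case: F0; exists x].
pose MP : pseudoPMetricType R :=
  HB.pack M (isPointed.Build M (h (SigSub (mem_set Fp)))).
have cM : compact [set: MP].
  have -> : [set: MP] = h @` [set: F].
    by apply/seteqP; split=> // x _; exists (g x).
  apply: continuous_compact (compact_set_type cF).
  by apply: continuous_subspaceT => x; exact: ch.
have [B cB [oB bB]] := compact_second_countable cM.
have [f fB] := countable_enum set0 cB.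
(* A member of the base of M is the trace on F of an open set of T. *)
have hV n : exists W : set T, open W /\
    (open (f n : set MP) -> set_val @^-1` W = h @^-1` (f n)).
  have [ofn|nofn] := pselect (open (f n : set MP)); last first.
    by exists set0; split => //; exact: open0.
  have /continuousP/(_ _ ofn) := ch.
  by move=> [W oW WE]; exists W.
have [V {}hV] := choice hV.
exists V; split=> [n|x U Fx oU Ux]; first by have [] := hV n.
have : nbhs (h (SigSub (mem_set Fx)) : MP) (g @^-1` (set_val @^-1` U)).
  apply: cg; rewrite hK; apply: open_nbhs_nbhs; split => //.
  by exists U.
move=> /(bB _)[W [BW Wx] WU]; have [n fn] := fB _ BW.
have [_ VE] := hV n.
have {}VE : set_val @^-1` (V n) = h @^-1` W by rewrite VE fn//; exact: oB.
exists n.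
  have : (h @^-1` W) (SigSub (mem_set Fx)) by [].
  by rewrite -VE.
move=> y [Vy Fy].
have : (set_val @^-1` (V n)) (SigSub (mem_set Fy)) by [].
by rewrite VE => /WU/=; rewrite hK.
Qed.

Section metrization.
Local Open Scope ring_scope.

Lemma metric_of_dist (R : realType) (X : choiceType) (d : X -> X -> R) :
  (forall x, d x x = 0) -> (forall x y, d x y = 0 -> x = y) ->
  (forall x y, d x y = d y x) ->
  (forall y x z, d x z <= d x y + d y z) ->
  exists (M : metricType R) (i : X -> M) (j : M -> X),
    [/\ cancel i j, cancel j i &
      forall x e, ball (i x) e = [set y | d x (j y) < e]].
Proof.
case: X d => X cX d dxx d0 dC dD.
pose metX := isMetric.Build R (Choice.Pack cX) dxx d0 dC dD.
pose M : metricType R := HB.pack X cX metX.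
by exists M, id, id; split.
Qed.

(** The weighted supremum distance sup_n |f_n x - f_n y| / (n + 1) is
    continuous, since up to epsilon only finitely many n matter; a continuous
    bijection from a compact space to a Hausdorff one is a homeomorphism. *)
Lemma compact_separated_metrizable (R : realType) (X : topologicalType)
    (f : nat -> X -> R) : compact [set: X] ->
  (forall n, continuous (f n)) -> (forall n x, 0 <= f n x <= 1) ->
  (forall x y, x <> y -> exists n, f n x <> f n y) ->
  metrizable R X.
Proof.
move=> cX cf f01 sepf.
pose e x y n : R := `|f n x - f n y| / n.+1%:R.
have e_ge0 x y n : 0 <= e x y n by rewrite divr_ge0.
have e_le x y n : e x y n <= n.+1%:R^-1.
  rewrite /e ler_piMl ?invr_ge0//.
  by have := f01 n x; have := f01 n y; rewrite ler_norml; lra.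
have e_sup x y : has_sup (range (e x y)).
  split; first by exists (e x y 0%N), 0%N.
  exists 1 => _ [n _ <-]; apply: le_trans (e_le _ _ _) _.
  by rewrite invf_le1// ler1n.
pose d x y := sup (range (e x y)).
have e_d x y n : e x y n <= d x y.
  by apply: sup_upper_bound; [exact: e_sup|exists n].
have d_le x y c : (forall n, e x y n <= c) -> d x y <= c.
  move=> h; apply: ge_sup; first by exists (e x y 0%N), 0%N.
  by move=> _ [n _ <-].
have d_ge0 x y : 0 <= d x y by exact: (le_trans (e_ge0 x y 0%N) (e_d _ _ _)).
have dxx x : d x x = 0.
  apply/eqP; rewrite eq_le d_ge0 andbT; apply: d_le => n.
  by rewrite /e subrr normr0 mul0r.
have d0 x y : d x y = 0 -> x = y.
  move=> dxy; apply: contrapT => /sepf[n]; apply; apply/eqP.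
  have := e_d x y n; rewrite dxy /e pmulr_lle0 ?invr_gt0 ?ltr0n//.
  by rewrite normr_le0 subr_eq0.
have dC x y : d x y = d y x.
  by rewrite /d (_ : e x y = e y x)//; apply/funext => n; rewrite /e distrC.
have dD y x z : d x z <= d x y + d y z.
  apply: d_le => n; apply: (@le_trans _ _ (e x y n + e y z n)); last exact: lerD.
  rewrite /e -mulrDl ler_pM2r ?invr_gt0//.
  by apply: (le_trans _ (ler_normD _ _)); rewrite addrA subrK.
have [M [i [j [ij ji ballE]]]] := metric_of_dist dxx d0 dC dD.
have ci : continuous i.
  move=> x; apply/cvg_ballP => eps eps0; rewrite ballE.
  have [N _ hN] : \forall n \near \oo, n.+1%:R^-1 < eps / 2 :> R.
    exact: (near_infty_natSinv_lt (PosNum (divr_gt0 eps0 (ltr0Sn R 1)))).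
  have : \forall y \near x, forall n : 'I_N, `|f n x - f n y| < eps / 2.
    apply: filter_forall => n.
    by have /cvgr_dist_lt := cf n x; apply; rewrite divr_gt0.
  apply: filterS => y hy /=; rewrite ij.
  apply: (@le_lt_trans _ _ (eps / 2)); last by lra.
  apply: d_le => n; have [nN|Nn] := ltnP n N.
    apply: (le_trans _ (ltW (hy (Ordinal nN)))).
    by rewrite /e ler_piMr// invf_le1// ler1n.
  by apply: le_trans (e_le _ _ _) (ltW (hN n Nn)).
exists M, i, j; split=> //.
apply/continuous_closedP => C cC.
have -> : j @^-1` C = i @` C.
  apply/seteqP; split=> [y Cy|_ [x Cx <-]]; last by rewrite /= ij.
  by exists (j y); rewrite ?ji.
apply: compact_closed; first exact: metric_hausdorff.
apply: continuous_compact; first by apply: continuous_subspaceT => x; exact: ci.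
exact: subclosed_compact cX _.
Qed.

(** Urysohn functions separating the closure of a basic subset of F from the
    complement of another one form a countable separating family. *)
Lemma base_metrizable (R : realType) (T : topologicalType) (F : set T) V :
  compact [set: T] -> hausdorff_space T -> closed F ->
  has_base_on F V -> metrizable R F.
Proof.
move=> cT hT clF [oV bV].
have normT := compact_normal hT cT.
have cF : compact F by exact: subclosed_compact cT _.
pose A i := closure (V i `&` F); pose C j := F `\` V j.
have hu (p : nat * nat) : exists u : T -> R, [/\ continuous u,
    forall x, 0 <= u x <= 1 & A p.1 `&` C p.2 = set0 ->
    (forall x, A p.1 x -> u x = 0) /\ (forall x, C p.2 x -> u x = 1)].
  have [AC0|nAC0] := pselect (A p.1 `&` C p.2 = set0); last first.
    by exists (fun=> 0); split=> // [x|x]; [exact: cvg_cst|rewrite lexx ler01].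
  have clC : closed (C p.2).
    by rewrite /C setDE; apply: closedI => //; exact: open_closedC.
  have := @normal_uniform_separator _ normT _ _ (@closed_closure _ _) clC AC0.
  move=> /(@uniform_separatorP _ R)[u [cu u01 uA uC]]; exists u; split=> // [x|_].
    by have := u01 (u x) (ex_intro2 _ _ x I erefl); rewrite /= in_itv.
  by split=> x hx; [apply: uA|apply: uC]; exists x.
have [u {}hu] := choice hu.
pose f n (x : F) : R := u (odflt (0, 0)%N (unpickle n)) (set_val x).
apply: (@compact_separated_metrizable R F f).
- exact: compact_set_type.
- move=> n x; have [cu _ _] := hu (odflt (0, 0)%N (unpickle n)).
  by apply: continuous_comp; [exact: initial_continuous|exact: cu].
- by move=> n x; have [_ u01 _] := hu (odflt (0, 0)%N (unpickle n)); exact: u01.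
move=> x y xy.
have Fx : F (set_val x) := set_valP x; have Fy : F (set_val y) := set_valP y.
have xy' : set_val x <> set_val y by move=> /val_inj.
have [U [U' [oU oU' Ux Uy UU']]] := hausdorff_separate hT xy'.
have [j Vjx VjU] := bV _ _ Fx oU Ux.
have Vjy : ~ V j (set_val y).
  move=> Vjy; have : (U `&` U') (set_val y) by split=> //; apply: VjU.
  by rewrite UU'.
have [W [oW Wx WV]] := compact_shrink cT hT (oV j) Vjx.
have [i Vix ViW] := bV _ _ Fx oW Wx.
exists (pickle (i, j)); rewrite /f pickleK/=.
have [_ _ []] := hu (i, j).
  apply/seteqP; split=> // z /= [Az [Fz]]; apply; apply: WV.
  by apply: closureS Az => w /ViW.
move=> u0 u1; rewrite u0 ?u1//; first by apply/eqP; rewrite eq_sym oner_eq0.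
by apply: subset_closure.
Qed.

End metrization.

(** For a finite union W of basic sets, the set of the points whose whole
    fibre lies in W is open; a fibre is compact, so such sets suffice. *)
Lemma image_base (S T : topologicalType) (f : S -> T) (F : set S) V :
  hausdorff_space T -> continuous f -> compact F -> has_base_on F V ->
  exists W, has_base_on (f @` F) W.
Proof.
move=> hT cf cF [oV bV].
pose cov (l : seq nat) := [set x | exists2 j, j \in l & V j x].
have ocov l : open (cov l).
  have -> : cov l = \bigcup_(j in [set j | j \in l]) V j.
    by apply/seteqP; split=> x [j jl Vx]; exists j.
  by apply: bigcup_open => j _; exact: oV.
pose W (l : seq nat) := ~` (f @` (F `\` cov l)).
exists (fun n => W (odflt [::] (unpickle n))); split=> [n|y U [x0 Fx0 fx0] oU Uy].
  apply: closed_openC; apply: image_closed => //; rewrite setDE.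
  by apply: compact_closedI => //; exact: open_closedC.
pose good j := V j `&` F `<=` f @^-1` U.
pose C := F `&` f @^-1` [set y].
have cC : compact C.
  apply: compact_closedI => //; apply: preimage_closed => [z _|]; first exact: cf.
  exact: hausdorff_closed1.
have oU' : open (f @^-1` U) by move/continuousP: cf; apply.
have [|N _ hN] := (compact_near_coveringP C).1 cC nat \oo
    (fun n x => exists j, [/\ (j < n)%N, good j & V j x]) _.
  move=> x [Fx fx]; have Ux : (f @^-1` U) x by rewrite /= fx.
  have [j Vjx gj] := bV _ _ Fx oU' Ux.
  exists (V j, [set n | (j < n)%N]) => /=.
    split; first exact: open_nbhs_nbhs.
    by exists j.+1.
  by move=> [x' n] /= [Vx' jn]; exists j.
have {hN} := hN N (leqnn N) => hN.
pose l := [seq j <- iota 0 N | `[<good j>]].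
exists (pickle l); rewrite pickleK/=.
  move=> [x [Fx ncov] fx]; apply: ncov.
  have [j [jN gj Vj]] := hN x (conj Fx fx).
  rewrite /cov; exists j => //.
  by rewrite mem_filter mem_iota add0n jN !andbT; apply/asboolP.
move=> z [Wz [x Fx fx]]; rewrite -fx.
have [j jl Vjx] : cov l x by apply: contrapT => ncov; apply: Wz; exists x.
by move: jl; rewrite mem_filter => /andP[/asboolP gj _]; exact: gj.
Qed.

Lemma base_closure_seq (T : topologicalType) (F A : set T) V x :
  has_base_on F V -> F x -> closure (A `&` F) x ->
  exists2 u : nat -> T, (forall n, A (u n)) & u @ \oo --> x.
Proof.
move=> [oV bV] Fx cAx.
have hu n : exists y, (A `&` F) y /\ forall k : 'I_n.+1, V k x -> V k y.
  have [|y [Ay Vy]] := cAx [set y | forall k : 'I_n.+1, V k x -> V k y].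
    apply: filter_forall => k; have [Vkx|nV] := pselect (V k x).
      by apply: filterS (open_nbhs_nbhs (conj (oV k) Vkx)).
    by apply: filterE => y /nV.
  by exists y.
have [u {}hu] := choice hu.
exists u => [n|]; first by have [[]] := hu n.
move=> B /nbhs_sub_open[U [oU Ux UB]].
have [k Vkx VU] := bV _ _ Fx oU Ux.
exists k => // n /= kn; have [[_ Fu] Vu] := hu n.
by apply: UB; apply: VU; split=> //; exact: (Vu (Ordinal (kn : k < n.+1)%N)).
Qed.

(** * Retractional skeletons and reflection *)

Section skeleton.
Context (R : realType) (K : topologicalType) (d : Order.disp_t)
  (G : porderType d) (r : G -> K -> K).
Hypothesis cK : compact [set: K].
Hypothesis hK : hausdorff_space K.
Hypothesis sk : retractional_skeleton R r.

Let D := \bigcup_s range (r s).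

Lemma skel_continuous s : continuous (r s).
Proof. exact: (@rskel_continuous _ _ _ _ _ sk s). Qed.

Lemma skel_fixP s x : range (r s) x <-> r s x = x.
Proof.
split=> [[y _ <-]|<-]; last by exists x.
exact: (congr1 (fun g => g y) (rskel_retraction sk s)).
Qed.

Lemma skel_idem s x : r s (r s x) = r s x.
Proof. by apply/skel_fixP; exists x. Qed.

Lemma skel_le_l s t x : (s <= t)%O -> r s (r t x) = r s x.
Proof. by move=> /(rskel_le sk)[rs _]; rewrite [in RHS]rs. Qed.

Lemma skel_le_r s t x : (s <= t)%O -> r t (r s x) = r s x.
Proof. by move=> /(rskel_le sk)[_ rs]; rewrite [in RHS]rs. Qed.

Lemma skel_range_mono s t : (s <= t)%O -> range (r s) `<=` range (r t).
Proof. by move=> st _ [x _ <-]; exists (r s x) => //; rewrite skel_le_r. Qed.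

Lemma skel_range_compact s : compact (range (r s)).
Proof. by apply: image_compact => //; exact: skel_continuous. Qed.

Lemma skel_inhabited : K -> inhabited G.
Proof.
move=> x; have [s _ _] := rskel_cvg sk (@filterT _ (nbhs x) _).
by exists.
Qed.

(** Dominate the indices of the points one after the other; the supremum of
    the resulting sequence works for all of them. *)
Lemma skel_countable_sub (E : set K) s0 : countable E -> E `<=` D ->
  exists2 t, (s0 <= t)%O & E `<=` range (r t).
Proof.
move=> cE ED.
have [[x0 Ex0]|E0] := pselect (exists x, E x); last first.
  by exists s0 => // x Ex; case: E0; exists x.
have [e eE] := countable_enum x0 cE.
have hi n : exists s, E (e n) -> range (r s) (e n).
  have [/ED[s _ ?]|] := pselect (E (e n)); first by exists s.
  by exists s0.
have [i {}hi] := choice hi.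
have hub (p : G * G) : exists u, (p.1 <= u)%O /\ (p.2 <= u)%O.
  exact: rskel_directed sk _ _.
have [ub {}hub] := choice hub.
pose v := fix v n := if n is m.+1 then ub (v m, i m) else s0.
have v_nd : nondecreasing_seq v.
  by apply/nondecreasing_seqP => n; exact: (hub (v n, i n)).1.
have [t [vt _]] := rskel_complete sk v_nd.
exists t; first by apply: vt; exists 0%N.
move=> x Ex; have [n en] := eE x Ex; rewrite -en.
apply: (@skel_range_mono (i n)); last by apply: hi; rewrite en.
apply: (@le_trans _ _ (v n.+1)); first exact: (hub (v n, i n)).2.
by apply: vt; exists n.+1.
Qed.

(** Convergence along suprema is part of a skeleton only for strictly
    increasing sequences; a nondecreasing one is eventually constant or has a
    strictly increasing subsequence with the same supremum. *)
Lemma skel_subseq_cvg (s : nat -> G) t : nondecreasing_seq s ->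
  supremums (range s) t ->
  exists k : nat -> nat, forall x, (fun n => r (s (k n)) x) @ \oo --> r t x.
Proof.
move=> s_nd s_t; have [s_le t_le] := s_t.
have [[N hN]|nconst] := pselect (exists N, forall n, (N <= n)%N -> s n = s N).
  exists (fun=> N) => x; suff -> : t = s N by exact: cvg_cst.
  apply/eqP; rewrite eq_le; apply/andP; split; last by apply: s_le; exists N.
  apply: t_le => _ [n _ <-]; have [/hN->//|/ltnW nN] := leqP N n.
  exact: s_nd.
have hnext N : exists n, (N < n)%N /\ (s N < s n)%O.
  apply: contrapT => h; apply: nconst; exists N => n Nn.
  apply: contrapT => nNs; apply: h; exists n.
  have sN : (s N < s n)%O by rewrite lt_neqAle s_nd// andbT eq_sym; exact/eqP.
  rewrite ltn_neqAle Nn andbT; split=> //.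
  by apply: contraTneq sN => ->; rewrite ltxx.
have [next {}hnext] := choice hnext.
pose k n := iter n next 0%N.
have k_ge n : (n <= k n)%N.
  by elim: n => // n IH; apply: leq_ltn_trans IH _; exact: (hnext (k n)).1.
exists k => x; apply: (rskel_sup sk (s := s \o k)) => [n|].
  exact: (hnext (k n)).2.
split=> [_ [n _ <-]|u hu]; first by apply: s_le; exists (k n).
apply: t_le => _ [n _ <-]; apply: (@le_trans _ _ (s (k n))); first exact: s_nd.
by apply: hu; exists n.
Qed.

(** The range of r_t is thus the inverse limit of the ranges of the r_(s n):
    every point y with r_t y outside U is separated from x by some r_(s m),
    hence by all later ones; by compactness one n serves for all y, and the
    complement of a compact image is the required V. *)
Lemma skel_sup_nbhs (s : nat -> G) t x U : nondecreasing_seq s ->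
  supremums (range s) t -> open U -> U (r t x) ->
  \forall n \near \oo, exists V, [/\ open V, V (r (s n) x) &
    forall y, V (r (s n) y) -> U (r t y)].
Proof.
move=> s_nd s_t oU Ux.
pose C := r t @^-1` ~` U.
have clC : closed C.
  apply: preimage_closed => [z _|]; last exact: open_closedC.
  exact: skel_continuous.
have cC : compact C by exact: subclosed_compact cK _.
have [|N _ hN] := (compact_near_coveringP C).1 cC nat \oo
    (fun n y => r (s n) y <> r (s n) x) _.
  move=> y Cy.
  have [m rm] : exists m, r (s m) y <> r (s m) x.
    apply: contrapT => heq; apply: Cy => /=.
    have [k hk] := skel_subseq_cvg s_nd s_t.
    rewrite (_ : r t y = r t x)//.
    apply: (cvg_unique hK (hk y)).
    suff -> : (fun n => r (s (k n)) y) = fun n => r (s (k n)) x by exact: hk.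
    by apply/funext => n; apply: contrapT => h; apply: heq; exists (k n).
  have [A [B [oA oB Ay Bx AB]]] := hausdorff_separate hK rm.
  exists (r (s m) @^-1` A, [set n | (m <= n)%N]) => /=.
    split; last by exists m.
    apply: open_nbhs_nbhs; split=> //.
    by move/continuousP: (@skel_continuous (s m)); exact.
  move=> [y' n] /= [Ay' mn] rn.
  have sm : (s m <= s n)%O by exact: s_nd.
  have : (A `&` B) (r (s m) y').
    by split=> //; rewrite -(skel_le_l _ sm) rn skel_le_l.
  by rewrite AB.
exists N => // n /hN{}hN.
exists (~` (r (s n) @` C)); split.
- apply: closed_openC; apply: image_closed => //; exact: skel_continuous.
- by move=> [y Cy] /(hN _ Cy).
- by move=> y nCy; apply: contrapT => nU; apply: nCy; exists y.
Qed.

(** The counterpart of a countable elementary submodel: [N s] is a countable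
    network seen at stage s, E s is a countable set of witnesses chosen from
    the data at stage s, and the index t collects the witnesses of infinitely
    many stages s_n, while the networks N (s_n) describe r_t. That every large
    n may be used allows finitely many points to be treated at the same stage. *)
Lemma skel_reflection : exists N : G -> nat -> set K,
  (forall s j, open (N s j)) /\
  forall E : G -> set K, (forall s, countable (E s)) ->
    (forall s, E s `<=` D) -> forall s0, exists t (s : nat -> G),
  [/\ (s0 <= t)%O, (forall n, E (s n) `<=` range (r t)) &
    forall x U, open U -> U (r t x) -> \forall n \near \oo, exists j,
      N (s n) j x /\ forall y, N (s n) j y -> U (r t y)].
Proof.
have hb s := metrizable_base (@skel_range_compact s) (rskel_metrizable sk s).
have [V {}hb] := choice hb.
exists (fun s j => r s @^-1` V s j); split=> [s j|E cE ED s0].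
  by move/continuousP: (@skel_continuous s); apply; exact: (hb s).1.
have hg s : exists u, (s <= u)%O /\ E s `<=` range (r u).
  by have [u su Eu] := skel_countable_sub s (cE s) (ED s); exists u.
have [g {}hg] := choice hg.
pose s n := iter n g s0.
have s_nd : nondecreasing_seq s.
  by apply/nondecreasing_seqP => n; exact: (hg (s n)).1.
have [t s_t] := rskel_complete sk s_nd.
have s_le n : (s n <= t)%O by apply: s_t.1; exists n.
exists t, s; split=> [|n|x U oU Ux]; first exact: (s_le 0%N).
  by apply: subset_trans (skel_range_mono (s_le n.+1)); exact: (hg (s n)).2.
apply: filterS (skel_sup_nbhs s_nd s_t oU Ux) => n [W [oW Wx WU]].
have Fx : range (r (s n)) (r (s n) x) by exists x.
have [j Vj VW] := (hb (s n)).2 _ _ Fx oW Wx.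
by exists j; split=> // y Vy; apply: WU; apply: VW; split=> //; exists y.
Qed.

End skeleton.

(** * Topology of an induced set *)

Section induced.
Context (R : realType) (K : topologicalType) (D : set K).
Hypothesis cK : compact [set: K].
Hypothesis hK : hausdorff_space K.
Hypothesis hD : induced_by_skeleton R D.

Lemma induced_dense : dense D.
Proof.
have [d [G [r [sk DE]]]] := hD; rewrite DE => U [x Ux] oU.
have [s _ hs] := rskel_cvg sk (open_nbhs_nbhs (conj oU Ux)).
by exists (r s x); split; [apply: hs => /=|exists s => //; exists x].
Qed.

(** The single compact F makes D countably compact: a sequence in D has a
    cluster point inside D. *)
Lemma induced_countable (E : set K) : countable E -> E `<=` D ->
  exists F, [/\ E `<=` F, compact F & F `<=` D].
Proof.
have [d [G [r [sk DE]]]] := hD; rewrite DE => cE ED.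
have [[x Ex]|E0] := pselect (exists x, E x); last first.
  exists set0; split=> // [x Ex|]; first by case: E0; exists x.
  exact: compact0.
have [s0] := skel_inhabited sk x.
have [t _ Et] := skel_countable_sub sk s0 cE ED.
exists (range (r t)); split=> //; first exact: (skel_range_compact cK sk).
by move=> y ry; exists t.
Qed.

(** Reflect, for each i and each network set meeting A i, one common point:
    near r_t x these points accumulate, and they lie in F, the range of r_t; y
    is r_t x. Several sets A i are handled by the same y, which is what
    separates closures. A prescribed point x0 of D can be put in F. *)
Lemma induced_closure (I : countType) (A : I -> set K) x0 :
  (forall i, A i `<=` D) -> D x0 ->
  exists F V, [/\ F `<=` D, F x0, has_base_on F V & forall x, exists y,
    [/\ F y, F x -> y = x &
      forall i, closure (A i) x -> closure (A i `&` F) y]].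
Proof.
have [d [G [r [sk DE]]]] := hD; rewrite DE => AD [s0 _ Fx0].
have [N [oN hN]] := skel_reflection cK hK sk.
have ha (p : G * nat * I) : exists a,
    A p.2 `&` N p.1.1 p.1.2 !=set0 -> (A p.2 `&` N p.1.1 p.1.2) a.
  have [[a Aa]|n0] := pselect (A p.2 `&` N p.1.1 p.1.2 !=set0).
    by exists a.
  by exists x0.
have [a {}ha] := choice ha.
pose E s := [set a (s, p.1, p.2) | p in
  [set p : nat * I | A p.2 `&` N s p.1 !=set0]].
have cE s : countable (E s).
  by apply: sub_countable (card_image_le _ _) _; exact: countableP.
have ED s : E s `<=` \bigcup_s range (r s).
  by move=> _ [p /= hp <-]; apply: (AD p.2); exact: (ha (s, p.1, p.2) hp).1.
have [t [s [s0t Et ht]]] := hN E cE ED s0.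
have [V bV] :=
  metrizable_base (skel_range_compact cK sk (s:=t)) (rskel_metrizable sk t).
exists (range (r t)), V; split=> //.
- by move=> y ry; exists t.
- exact: (skel_range_mono sk s0t).
move=> x; exists (r t x); split=> [|/(skel_fixP sk)//|i cAx]; first by exists x.
apply/closureP => U oU Ux.
have [n _ /(_ n (leqnn n))[j [Nx NU]]] := ht x U oU Ux.
have hp : A i `&` N (s n) j !=set0.
  by have [y Ay Ny] := (closureP _ _).1 cAx _ (oN _ _) Nx; exists y.
have [Aa Na] := ha (s n, j, i) hp.
have Fa : range (r t) (a (s n, j, i)) by apply: (Et n); exists (j, i).
exists (a (s n, j, i)) => //.
by have := NU _ Na; rewrite ((skel_fixP sk t _).1 Fa).
Qed.

Lemma induced_closure_seq (A : set K) x : A `<=` D -> D x -> closure A x ->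
  exists2 u : nat -> K, (forall n, A (u n)) & u @ \oo --> x.
Proof.
move=> AD Dx cAx.
have [F [V [FD Fx bV /(_ x)[y [_ /(_ Fx)-> cA]]]]] :=
  @induced_closure unit (fun=> A) x (fun=> AD) Dx.
exact: base_closure_seq bV Fx (cA tt cAx).
Qed.

(** A common point x of the closures in K reflects to a common point of the
    closures inside D. *)
Lemma induced_disjoint_closure (P Q : set K) : P `<=` D -> Q `<=` D ->
  closure P `&` closure Q `&` D = set0 -> closure P `&` closure Q = set0.
Proof.
move=> PD QD PQ0; apply/seteqP; split=> // x [cP cQ].
have [x0 Px0 _] := (closureP _ _).1 cP setT openT I.
have [|F [V [FD _ _ /(_ x)[y [Fy _ cA]]]]] :=
  @induced_closure bool (fun b => if b then P else Q) x0 _ (PD _ Px0).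
  by case.
suff : (closure P `&` closure Q `&` D) y by rewrite PQ0.
split; last exact: FD.
by split; [apply: closureS (cA true cP)|apply: closureS (cA false cQ)] => ? [].
Qed.

Lemma induced_frechet_urysohn : frechet_urysohn D.
Proof.
move=> A x /closure_set_val cAx.
have [||u uA ux] := induced_closure_seq _ _ cAx.
- by move=> _ [y _ <-]; exact: set_valP.
- exact: set_valP.
have [v hv] := choice (fun n => let: ex_intro2 y Ay yu := uA n in
  ex_intro (fun y => A y /\ set_val y = u n) y (conj Ay yu)).
exists v => [n|]; first by have [] := hv n.
apply: (@cvg_set_val _ _ D \oo v x); suff -> : (fun n => set_val (v n)) = u by [].
by apply/funext => n; have [] := hv n.
Qed.

End induced.

(** Taimanov's criterion. The value at x is a cluster point of f along the
    traces on D of the neighbourhoods of x; it is in fact a limit, since f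
    cannot take values in both sides of a pair of disjoint closed sets near x. *)
Lemma dense_extension (X Z : topologicalType) (D : set X) (f : D -> Z) :
  compact [set: Z] -> hausdorff_space Z -> dense D -> continuous f ->
  (forall P Q : set Z, closed P -> closed Q -> P `&` Q = set0 ->
    closure (set_val @` (f @^-1` P)) `&` closure (set_val @` (f @^-1` Q)) =
      set0) ->
  exists F : X -> Z, continuous F /\ sigL D F = f.
Proof.
move=> cZ hZ dD cf sepf.
pose im (U : set X) := f @` (set_val @^-1` U).
have hF x : exists z, forall U, open U -> U x -> closure (im U) z.
  pose B := filter_from [set U | open U /\ U x] im.
  have PB : ProperFilter B.
    apply: filter_from_proper => [|U [oU Ux]].
      apply: filter_from_filter; first by exists setT; split=> //; exact: openT.
      move=> U V [oU Ux] [oV Vx]; exists (U `&` V); first by split=> //; exact: openI.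
      by move=> _ [y [Uy Vy] <-]; split; exists y.
    have [y [Uy Dy]] : U `&` D !=set0 by apply: dD => //; exists x.
    by exists (f (SigSub (mem_set Dy))), (SigSub (mem_set Dy)).
  have [|z [_ clz]] := cZ B PB.
    by exists setT => //; split=> //; exact: openT.
  by exists z => U oU Ux W Wz; apply: clz => //; exists U.
have [F {}hF] := choice hF.
have small x U : open U -> U (F x) -> exists W, [/\ open W, W x & im W `<=` U].
  move=> oU Ux; have [W [oW Wx WU]] := compact_shrink cZ hZ oU Ux.
  have PQ0 : closure W `&` ~` U = set0.
    by apply/seteqP; split=> // z [/WU].
  have cx : closure (set_val @` (f @^-1` closure W)) x.
    apply/closureP => V oV Vx.
    have [_ [y Vy <-] Wy] := (closureP _ _).1 (hF x V oV Vx) _ oW Wx.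
    by exists (set_val y) => //; exists y => //; exact: subset_closure.
  have ncx : ~ closure (set_val @` (f @^-1` (~` U))) x.
    move=> cx'; have := sepf _ _ (@closed_closure _ W) (open_closedC oU) PQ0.
    by move/seteqP => [/(_ x (conj cx cx'))].
  move/closureP/existsNP: ncx => [V] /not_implyP[oV] /not_implyP[Vx nV].
  exists V; split=> // _ [y Vy <-]; apply: contrapT => nU.
  by apply: nV; exists (set_val y) => //; exists y.
exists F; split.
  move=> x B /nbhs_sub_open[U [oU Ux UB]].
  have [W [oW Wx WU]] := compact_shrink cZ hZ oU Ux.
  have [V [oV Vx VW]] := small x W oW Wx.
  have : nbhs x V by exact: open_nbhs_nbhs.
  apply: filterS => y Vy /=; apply/UB/WU.
  exact: closureS VW _ (hF y V oV Vy).
apply/funext => x; apply: contrapT => /(hausdorff_separate hZ).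
move=> [A [B [oA oB Ax Bx AB]]].
have /continuousP/(_ _ oB)[V oV VE] := cf.
have Vx : V (set_val x).
  by have : (f @^-1` B) x by []; rewrite -VE.
have [_ [y Vy <-] Ay] := (closureP _ _).1 (hF (set_val x) V oV Vx) _ oA Ax.
have By : (f @^-1` B) y by rewrite -VE.
by have : (A `&` B) (f y) by []; rewrite AB.
Qed.

Lemma induced_stone_cech (R : realType) (K : topologicalType) (D : set K) :
  compact [set: K] -> hausdorff_space K -> induced_by_skeleton R D ->
  is_stone_cech D.
Proof.
move=> cK hK hD; split=> // [|Z f cZ hZ cf]; first exact: induced_dense hD.
apply: dense_extension => //; first exact: induced_dense hD.
move=> P Q cP cQ PQ0; apply: (induced_disjoint_closure cK hK hD).
- by move=> _ [y _ <-]; exact: set_valP.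
- by move=> _ [y _ <-]; exact: set_valP.
apply/seteqP; split=> // x [[clP clQ] Dx].
have key C : closed C -> closure (set_val @` (f @^-1` C)) x ->
    C (f (SigSub (mem_set Dx))).
  move=> cC /closureP clC.
  have : closed (f @^-1` C) by move/continuous_closedP: cf; apply.
  apply; apply/closureP => _ [U oU <-] Ux.
  by have [_ [y Cy <-] Uy] := clC U oU Ux; exists y.
suff : (P `&` Q) (f (SigSub (mem_set Dx))) by rewrite PQ0.
by split; exact: key.
Qed.

(** * Pointwise closed sets of functions *)

Section pointwise.
Local Open Scope ring_scope.

Lemma tau_p_eval_continuous (R : realType) (K : topologicalType) (D : set K) x :
  D x -> continuous ((fun f => f x) : tau_p R D -> R).
Proof.
move=> Dx f.
pose rho (g : tau_p R D) : {ptws D -> R} := sigL D g.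
have crho : rho @ f --> rho f by exact: initial_continuous.
have := (@pointwise_cvgP _ _ (rho @ f) (rho f) _).1 crho (SigSub (mem_set Dx)).
by apply; apply: (@fmap_filter _ _ rho (nbhs f)).
Qed.

(** Basic neighbourhoods of f for pointwise convergence on D: finitely many
    points and one tolerance. *)
Lemma tau_p_closed_separate (R : realType) (K : topologicalType) (D : set K)
    (P : set (continuousType K R)) (f : continuousType K R) :
  closed (P : set (tau_p R D)) -> ~ P f ->
  exists (l : seq K) (e : R), [/\ 0 < e, (forall x, x \in l -> D x) &
    forall g, P g -> exists2 x, x \in l & e <= `|g x - f x|].
Proof.
move=> clP nPf; apply: contrapT => nsep; apply: nPf.
pose W (p : seq K * R) : set (tau_p R D) :=
  [set g | P g /\ forall x, x \in p.1 -> `|g x - f x| < p.2].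
pose I := [set p : seq K * R | 0 < p.2 /\ forall x, x \in p.1 -> D x].
pose B := filter_from I W.
have PB : ProperFilter B.
  apply: filter_from_proper => [|[l e] [/= e0 lD]].
    apply: filter_from_filter; first by exists ([::], 1); split.
    move=> [l e] [l' e'] [/= e0 lD] [/= e0' lD'].
    exists (l ++ l', Num.min e e').
      split=> /= [|x]; first by rewrite lt_min e0.
      by rewrite mem_cat => /orP[/lD|/lD'].
    move=> g [/= Pg hg]; split; split=> //= x xl.
      by have := hg x; rewrite mem_cat xl lt_min => /(_ isT)/andP[].
    by have := hg x; rewrite mem_cat xl orbT lt_min => /(_ isT)/andP[].
  apply: contrapT => W0; apply: nsep; exists l, e; split=> // g Pg.
  apply: contrapT => ne; apply: W0; exists g; split=> //= x xl.
  by rewrite ltNge; apply/negP => ex; apply: ne; exists x.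
pose rho (g : tau_p R D) : {ptws D -> R} := sigL D g.
have rhoB : rho @ B --> rho f.
  apply/pointwise_cvgP => x.
  apply/cvgrPdist_lt => e e0; exists ([:: set_val x], e).
    split=> //= y; rewrite inE => /eqP ->; exact: set_valP.
  by move=> g [_ /(_ (set_val x))/=]; rewrite inE eqxx distrC; apply.
have Bf : B --> (f : tau_p R D).
  move=> A [_ [[C oC <-] /= Cf] CA].
  have /rhoB : nbhs (rho f) C by exact: open_nbhs_nbhs.
  by apply: (@filterS _ B _ (rho @^-1` C)) => g Cg; exact: CA.
apply: clP => A Af; have [g [Ag Wg]] : (A `&` P) !=set0.
  apply: (@filter_ex _ B); apply: filterI; first exact: Bf.
  by exists ([::], 1) => [|g []//]; split.
by exists g.
Qed.

(** The Sokolov-type property of C(K): closed sets are preserved by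
    composition with cofinally many r_t. At stage s, for every finite list of
    network sets and rational numbers, witnesses xi are chosen such that no
    member of P takes values close to the given rationals at the points of xi.
    If f o r_t were outside P, the list describing f o r_t at points x_1, ...,
    x_m would admit witnesses, hence witnesses fixed by r_t; there f agrees
    with f o r_t and takes values close to the rationals, against f being in
    P. *)
Lemma skel_preserves_closed (R : realType) (K : topologicalType) d
    (G : porderType d) (r : G -> K -> K) (P : set (continuousType K R)) s0 :
  compact [set: K] -> hausdorff_space K -> retractional_skeleton R r ->
  closed (P : set (tau_p R (\bigcup_s range (r s)))) ->
  exists2 t, (s0 <= t)%O &
    forall f g : continuousType K R, P f -> g =1 f \o r t -> P g.
Proof.
move=> cK hK sk clP; set D := \bigcup_s range (r s) in clP *.
have [[k0 _]|noK] := pselect (exists x : K, True); last first.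
  exists s0 => // f g Pf _; suff -> : g = f by [].
  by apply/continuousEP => x; case: noK; exists x.
have [N [oN hN]] := skel_reflection cK hK sk.
(* A pair p = (k, [:: (j_0, q_0); (j_1, q_1); ...]) is a code for the tolerance
   1 / (k + 1), the network sets N s j_i and the rational values q_i. *)
pose size_of (p : nat * seq (nat * rat)) := size p.2.
pose nb s (p : nat * seq (nat * rat)) i := N s (nth (0%N, 0) p.2 i).1.
pose val (p : nat * seq (nat * rat)) i : R := ratr (nth (0%N, 0) p.2 i).2.
pose Phi s p (xi : nat -> K) :=
  (forall i, (i < size_of p)%N -> D (xi i) /\ nb s p i (xi i)) /\
  forall g, P g -> exists2 i, (i < size_of p)%N &
    ~ `|g (xi i) - val p i| < p.1.+1%:R^-1.
have hc (q : G * (nat * seq (nat * rat))) : exists xi,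
    (exists xi', Phi q.1 q.2 xi') -> Phi q.1 q.2 xi.
  have [[xi hxi]|no] := pselect (exists xi, Phi q.1 q.2 xi); first by exists xi.
  by exists (fun=> k0).
have [c {}hc] := choice hc.
pose E s := [set c (s, q.1) q.2 | q in
  [set q : (nat * seq (nat * rat)) * nat |
    (q.2 < size_of q.1)%N /\ exists xi, Phi s q.1 xi]].
have cE s : countable (E s).
  by apply: sub_countable (card_image_le _ _) _; exact: countableP.
have ED s : E s `<=` D.
  by move=> _ [[p i] /= [ip ex] <-]; exact: ((hc (s, p) ex).1 i ip).1.
have [t [s [s0t Et ht]]] := hN E cE ED s0.
exists t => // f g Pf gE; apply: contrapT => nPg.
have [l [e [e0 lD sep]]] := tau_p_closed_separate clP nPg.
(* The family x extends the list l beyond its size m by k0, so that rational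
   approximations can be chosen for all indices at once. *)
pose m := size l; pose x i := nth k0 l i.
(* Half of e: one half is spent on the approximation by rationals. *)
have [k _ hk] : \forall k \near \oo, k.+1%:R^-1 < e / 2 :> R.
  exact: (near_infty_natSinv_lt (PosNum (divr_gt0 e0 (ltr0Sn R 1)))).
have {hk} := hk k (leqnn k) => hk; set dl : R := k.+1%:R^-1 in hk.
have dl0 : 0 < dl by rewrite invr_gt0.
have hq i : exists q : rat, `|g (x i) - ratr q| < dl.
  have [|q] := @rat_in_itvoo R (g (x i) - dl) (g (x i) + dl); first by lra.
  by rewrite in_itv/= => hq; exists q; rewrite ltr_distlC; lra.
have [q {}hq] := choice hq.
pose U i := f @^-1` [set y | `|y - ratr (q i)| < dl].
have oU i : open (U i).
  have /continuousP := @cts_fun _ _ f; apply.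
  rewrite (_ : mkset _ = ball (ratr (q i) : R) dl); first exact: ball_open.
  by apply/seteqP; split=> y; rewrite /ball/= distrC.
have Ux i : U i (r t (x i)) by have := hq i; rewrite gE.
have [n hn] : exists n, forall i : 'I_m, exists j,
    N (s n) j (x i) /\ forall y, N (s n) j y -> U i (r t y).
  have [n _ hn] : \forall n \near \oo, forall i : 'I_m, exists j,
      N (s n) j (x i) /\ forall y, N (s n) j y -> U i (r t y).
    by apply: filter_forall => i; exact: ht (oU i) (Ux i).
  by exists n; exact: (hn n (leqnn n)).
have hj i : exists j, (i < m)%N ->
    N (s n) j (x i) /\ forall y, N (s n) j y -> U i (r t y).
  have [im|mi] := ltnP i m; last by exists 0%N.
  by have [j hj] := hn (Ordinal im); exists j.
have [j {}hj] := choice hj.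
pose p := (k, mkseq (fun i => (j i, q i)) m).
have pm : size_of p = m by exact: size_mkseq.
have ex : exists xi, Phi (s n) p xi.
  exists x; split=> [i|h Ph]; rewrite pm.
    move=> im; split; first by apply: lD; exact: mem_nth.
    by rewrite /nb nth_mkseq//; exact: (hj i im).1.
  have [y yl ey] := sep h Ph.
  exists (index y l); first by rewrite index_mem.
  rewrite /val nth_mkseq ?index_mem//= => hy.
  have yE : x (index y l) = y by exact: nth_index.
  have := hq (index y l); rewrite yE in hy *.
  move: ey hy; rewrite -/dl !ltr_norml ler_normr; lra.
have [cD cP] := hc (s n, p) ex.
have [i] := cP f Pf; rewrite pm => im; apply.
have [_ hi] := hj i im.
have := cD i; rewrite pm /nb nth_mkseq// => /(_ im)[_ /hi].
have : range (r t) (c (s n, p) i) by apply: (Et n); exists (p, i) => //=; rewrite pm.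
by move=> /(skel_fixP sk) ->; rewrite /U /val nth_mkseq.
Qed.

End pointwise.

(** * Continuous images *)

(** An index s is compatible when r_s respects the fibres of phi; then r_s
    descends to the retraction rho_s of L with rho_s o phi = phi o r_s.
    Compatibility passes to suprema of sequences because L is Hausdorff, so
    the compatible indices inherit the order structure required of a skeleton. *)
Lemma compatible_skeleton (R : realType) (K L : topologicalType) d
    (G : porderType d) (r : G -> K -> K) (phi : K -> L) :
  compact [set: K] -> hausdorff_space K ->
  compact [set: L] -> hausdorff_space L ->
  retractional_skeleton R r -> continuous phi -> range phi = [set: L] ->
  (forall s0, exists2 t, (s0 <= t)%O &
    forall x y, phi x = phi y -> phi (r t x) = phi (r t y)) ->
  induced_by_skeleton R (phi @` \bigcup_s range (r s)).
Proof.
move=> cK hK cL hL sk cphi sphi cofin.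
pose compat s := forall x y, phi x = phi y -> phi (r s x) = phi (r s y).
pose G' : porderType d := sub_type {s : G | `[<compat s>]}.
have G'P (s : G') : compat (val s) by have /asboolP := valP s.
have G'ex s : compat s -> exists s' : G', val s' = s.
  by move=> /asboolP cs; exists (exist _ s cs).
have phi_onto y : exists x, phi x = y.
  have [x _ <-] : range phi y by rewrite sphi.
  by exists x.
have [sigma hsigma] := choice phi_onto.
pose rho (s : G') y := phi (r (val s) (sigma y)).
have rhoE s x : rho s (phi x) = phi (r (val s) x) by exact: G'P.
have rangeE s : range (rho s) = phi @` range (r (val s)).
  apply/seteqP; split=> [_ [y _ <-]|_ [_ [x _ <-] <-]].
    by exists (r (val s) (sigma y)) => //; exists (sigma y).
  by exists (phi x) => //; rewrite rhoE.
have compat_sup (s : nat -> G) t : nondecreasing_seq s -> supremums (range s) t ->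
    (forall n, compat (s n)) -> compat t.
  move=> s_nd s_t cs x y xy; have [k hk] := skel_subseq_cvg sk s_nd s_t.
  have kx : phi (r (s (k n)) x) @[n --> \oo] --> phi (r t x).
    by apply: continuous_cvg; [exact: cphi|exact: hk].
  have ky : phi (r (s (k n)) y) @[n --> \oo] --> phi (r t y).
    by apply: continuous_cvg; [exact: cphi|exact: hk].
  apply: (cvg_unique hL kx); suff -> : (fun n => phi (r (s (k n)) x)) =
    (fun n => phi (r (s (k n)) y)) by [].
  by apply/funext => n; exact: cs.
have G'sup (s : nat -> G') : nondecreasing_seq s ->
    exists t : G', supremums (range s) t /\ supremums (range (val \o s)) (val t).
  move=> s_nd.
  have [t s_t] := rskel_complete sk (s_nd : nondecreasing_seq (val \o s)).
  have [t' tE] : exists t' : G', val t' = t.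
    by apply: G'ex; apply: compat_sup s_t _ => // n; exact: G'P.
  exists t'; rewrite tE; split=> //; split=> [_ [n _ <-]|u hu].
    by rewrite leEsub/= tE; apply: s_t.1; exists n.
  rewrite leEsub tE; apply: s_t.2 => _ [n _ <-].
  by rewrite -leEsub; apply: hu; exists n.
exists d, G', rho; split; last first.
  apply/seteqP; split=> [_ [x [s _ rx] <-]|y [s _]]; last first.
    by rewrite rangeE => -[x rx <-]; exists x => //; exists (val s).
  have [t st /G'ex[t' tE]] := cofin s.
  exists t' => //; rewrite rangeE tE.
  by exists x => //; apply: (skel_range_mono sk st).
split.
- move=> s t; have [u [su tu]] := rskel_directed sk (val s) (val t).
  have [v uv /G'ex[v' vE]] := cofin u.
  exists v'; rewrite !leEsub vE.
  by split; [exact: le_trans su uv|exact: le_trans tu uv].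
- by move=> s /G'sup[t [st _]]; exists t.
- move=> s; apply/continuous_closedP => C cC.
  have -> : rho s @^-1` C = phi @` (r (val s) @^-1` (phi @^-1` C)).
    apply/seteqP; split=> [y Cy|_ [x Cx <-]]; last by rewrite /= rhoE.
    by exists (sigma y) => //; rewrite /= -rhoE hsigma.
  apply: image_closed => //; apply: (subclosed_compact _ cK) => //.
  have /continuous_closedP := @skel_continuous _ _ _ _ _ sk (val s); apply.
  by have /continuous_closedP := cphi; apply.
- move=> s; apply/funext => y /=.
  by rewrite -(hsigma y) !rhoE (skel_idem sk).
- move=> s; rewrite rangeE.
  have cF := skel_range_compact cK sk (s:=val s).
  have [V bV] := metrizable_base cF (rskel_metrizable sk (val s)).
  have [W bW] := image_base hL cphi cF bV.
  apply: base_metrizable bW => //; exact: image_closed.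
- move=> y; rewrite -(hsigma y) => U Uy.
  have [s0 _ hs] := rskel_cvg sk (cphi _ _ Uy).
  have [s s0s /G'ex[s' sE]] := cofin s0.
  exists s' => // t /= st; rewrite rhoE; apply: hs => /=.
  by apply: le_trans s0s _; rewrite -sE -leEsub.
- move=> s t st; split; apply/funext => y /=; rewrite -(hsigma y) !rhoE.
    by rewrite (skel_le_l sk).
  by rewrite (skel_le_r sk).
move=> s t s_inc s_t y; rewrite -(hsigma y).
have s_nd : nondecreasing_seq s by apply/nondecreasing_seqP => n; exact: ltW.
have [t' [s_t' vs_t']] := G'sup s s_nd.
have <- : t' = t by exact: is_subset1_supremums s_t' s_t.
rewrite rhoE (_ : (fun n => _) = fun n => phi (r (val (s n)) (sigma y))); last first.
  by apply/funext => n; rewrite rhoE.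
apply: continuous_cvg; first exact: cphi.
exact: rskel_sup sk (val \o s) (val t') _ _ _.
Qed.

Lemma continuous_separate (R : realType) (L : topologicalType) (a b : L) :
  compact [set: L] -> hausdorff_space L -> a <> b ->
  exists u : continuousType L R, u a <> u b.
Proof.
move=> cL hL ab.
have ab0 : [set a] `&` [set b] = set0 by apply/seteqP; split=> // x [/= -> /ab].
have := @normal_uniform_separator _ (compact_normal hL cL) _ _
  (@hausdorff_closed1 _ a hL) (@hausdorff_closed1 _ b hL) ab0.
move=> /(@uniform_separatorP _ R)[u [cu _ ua ub]].
have ua0 : u a = 0%R by apply: ua; exists a.
have ub1 : u b = 1%R by apply: ub; exists b.
exists (mkcts cu) => uab; have : u a = u b by exact: uab.
by rewrite ua0 ub1 => /eqP; rewrite eq_sym oner_eq0.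
Qed.

Section image.
Context (R : realType) (K L : topologicalType) (phi : K -> L) (D : set K).
Hypothesis cK : compact [set: K].
Hypothesis hK : hausdorff_space K.
Hypothesis cL : compact [set: L].
Hypothesis hL : hausdorff_space L.
Hypothesis cphi : continuous phi.
Hypothesis sphi : range phi = [set: L].
Hypothesis hD : induced_by_skeleton R D.

(** If phi x = phi y but phi (r_t x) and phi (r_t y) were separated by u in
    C(L), then u o phi o r_t, which again factors through phi, would
    distinguish x from y. *)
Lemma closed_pullback_induced :
  closed (pullback R phi : set (tau_p R D)) -> induced_by_skeleton R (phi @` D).
Proof.
have [d [G [r [sk ->]]]] := hD => clP.
apply: compatible_skeleton => // s0.
have [t s0t ht] := skel_preserves_closed s0 cK hK sk clP.
exists t => // x y xy; apply: contrapT => /(continuous_separate R cL hL)[u].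
apply.
have cf : continuous (u \o phi).
  by move=> z; apply: continuous_comp; [exact: cphi|exact: cts_fun].
have cg : continuous (u \o phi \o r t).
  by move=> z; apply: continuous_comp; [exact: skel_continuous sk _ _|exact: cf].
have [|//|v /(congr1 (fun g => g _)) vE] := ht (mkcts cf) (mkcts cg).
  by exists u.
by rewrite -[LHS]/(mkcts cg x) -[RHS]/(mkcts cg y) !vE /= xy.
Qed.

(** If the preimage of V is closed in D and points of V converge to y, lifts
    of these points to D have a cluster point in D by countable compactness;
    it lies in the preimage of V and maps to y. *)
Lemma frechet_urysohn_quotient : frechet_urysohn (phi @` D) ->
  quotient_mapping (sigLR [fun phi in D]).
Proof.
set f := sigLR _ => fuB.
have fE x : set_val (f x) = phi (set_val x) by [].
have fsurj y : exists x, f x = y.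
  have [x Dx xy] : (phi @` D) (set_val y) by exact: set_valP.
  exists (SigSub (mem_set Dx)); apply: val_inj.
  exact: (etrans (fE (SigSub (mem_set Dx))) xy).
have cf : continuous f.
  apply/continuousP => _ [U oU <-].
  exists (phi @^-1` U); first by move/continuousP: cphi; apply.
  by apply/seteqP; split=> x; rewrite /= fE.
split; first by apply/seteqP; split=> // y _; have [x <-] := fsurj y; exists x.
move=> U; split; first by move/continuousP: cf; apply.
move=> oU; rewrite -closedC => y cy; have [u uU uy] := fuB _ _ cy.
have [v hv] := choice (fun n => fsurj (u n)).
pose E := range (fun n => set_val (v n)).
have [||F [EF cF FD]] := induced_countable cK hD (E := E).
- by apply: sub_countable (card_image_le _ _) _; exact: countableP.
- by move=> _ [n _ <-]; exact: set_valP.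
have [|x [Fx clx]] := cF ((fun n => set_val (v n)) @ \oo) _.
  by exists 0%N => // n _; apply: EF; exists n.
have Dx := FD _ Fx; pose x' : D := SigSub (mem_set Dx).
have x'U : (f @^-1` ~` U) x'.
  have : closed (f @^-1` ~` U) by rewrite preimage_setC; exact: open_closedC.
  apply; apply/closureP => _ [W oW <-] Wx.
  have [||_ [[n _ <-] Wn]] := clx (range (fun n => set_val (v n))) W.
  - by exists 0%N => // n _; exists n.
  - exact: open_nbhs_nbhs.
  by exists (v n) => //=; rewrite hv; exact: uU.
suff <- : f x' = y by [].
apply: contrapT => fxy.
have fxy' : set_val (f x') <> set_val y by move=> /val_inj.
have [A [B [oA oB Ax By AB]]] := hausdorff_separate hL fxy'.
have yB : nbhs y (set_val @^-1` B) by apply: open_nbhs_nbhs; split=> //; exists B.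
have [N _ hN] := uy _ yB.
have [||z [[n Nn nz] Az]] :=
  clx [set set_val (v n) | n in [set n | (N <= n)%N]] (phi @^-1` A).
- by exists N => // n /= Nn; exists n.
- apply: open_nbhs_nbhs; split; first by move/continuousP: cphi; apply.
  exact: Ax.
have : (A `&` B) (phi z).
  by split=> //; rewrite -nz -fE hv; exact: hN.
by rewrite AB.
Qed.

(** A limit g of functions in the pullback is constant on the fibres of phi in
    D, so it descends to B, continuously because of the quotient topology. The
    range of g serves as the compact target of the extension to L; density of
    D concludes. *)
Lemma quotient_closed_pullback : is_stone_cech (phi @` D) ->
  quotient_mapping (sigLR [fun phi in D]) ->
  closed (pullback R phi : set (tau_p R D)).
Proof.
set f := sigLR _ => scB [fsurj fopen] g clg.
have fE x : set_val (f x) = phi (set_val x) by [].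
have gfib a b : D a -> D b -> phi a = phi b -> g a = g b.
  move=> Da Db ab; apply: contrapT => /(hausdorff_separate (@Rhausdorff R)).
  move=> [A [B [oA oB Aa Bb AB]]].
  have [|h [[u uE] [Ah Bh]]] := clg
    ([set h : tau_p R D | A (h a)] `&` [set h : tau_p R D | B (h b)]).
    apply: filterI.
      by apply: (tau_p_eval_continuous Da); exact: open_nbhs_nbhs.
    by apply: (tau_p_eval_continuous Db); exact: open_nbhs_nbhs.
  have : (A `&` B) (h a).
    by split=> //; move: Bh; rewrite /= uE /= ab.
  by rewrite AB.
pose Z := range g.
have cZ : compact [set: Z].
  by apply: compact_set_type; apply: image_compact => //; exact: cts_fun.
have hZ : hausdorff_space Z by apply: set_type_hausdorff; exact: Rhausdorff.
have hlift (y : phi @` D) : exists z : Z,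
    forall x, D x -> phi x = set_val y -> set_val z = g x.
  have [x Dx xy] : (phi @` D) (set_val y) by exact: set_valP.
  have gx : range g (g x) by exists x.
  by exists (SigSub (mem_set gx)) => x' Dx' xy'; apply: gfib; rewrite // xy.
have [h hh] := choice hlift.
have ch : continuous h.
  apply/continuousP => _ [U oU <-]; apply/fopen.
  exists (g @^-1` U); first by have /continuousP := @cts_fun _ _ g; apply.
  have gE x : set_val (h (f x)) = g (set_val x) by apply: hh => //; exact: set_valP.
  by apply/seteqP; split=> x; rewrite /= gE.
have [F [cF FE]] := stone_cech_extend scB cZ hZ ch.
have cF' : continuous (set_val \o F : L -> R).
  by move=> y; apply: continuous_comp; [exact: cF|exact: initial_continuous].
exists (mkcts cF'); apply/funext => x; rewrite /mkcts /=.
pose A := [set x | g x = set_val (F (phi x))].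
have clA : closed A.
  rewrite -openC openE => z /(hausdorff_separate (@Rhausdorff R)).
  move=> [U [V [oU oV Uz Vz UV]]].
  have nU : nbhs z (g @^-1` U) by apply: cts_fun; exact: open_nbhs_nbhs.
  have nV : nbhs z [set w | V (set_val (F (phi w)))].
    by apply: (continuous_comp (@cphi z) (cF' (phi z))); exact: open_nbhs_nbhs.
  apply: filterS2 nU nV => w Uw Vw Aw.
  have : (U `&` V) (g w) by split=> //; rewrite Aw.
  by rewrite UV.
suff : A x by [].
apply: clA; apply/closureP => U oU Ux.
have [w [Uw Dw]] := induced_dense hD (ex_intro _ x Ux) oU.
exists w => //; rewrite /A /=.
have Bw : (phi @` D) (phi w) by exists w.
have -> : F (phi w) = h (SigSub (mem_set Bw)) by rewrite -FE.
by rewrite (hh _ w).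
Qed.

End image.

Theorem theorem4p5 (R : realType) (K L : topologicalType)
    (cK : compact [set: K]) (hK : hausdorff_space K)
    (cL : compact [set: L]) (hL : hausdorff_space L)
    (phi : K -> L) (phi_cont : continuous phi) (phi_surj : range phi = [set: L])
    (D : set K) (hD : induced_by_skeleton R D) :
  let B := phi @` D in
  [<-> induced_by_skeleton R B;
       closed (pullback R phi : set (tau_p R D));
       is_stone_cech B /\ frechet_urysohn B;
       is_stone_cech B /\ quotient_mapping (sigLR [fun phi in D])].
Proof.
move=> B.
have i_iii : induced_by_skeleton R B -> is_stone_cech B /\ frechet_urysohn B.
  move=> hB; split; first exact: induced_stone_cech hB.
  exact: induced_frechet_urysohn hB.
have iii_iv : is_stone_cech B /\ frechet_urysohn B ->
    is_stone_cech B /\ quotient_mapping (sigLR [fun phi in D]).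
  move=> [scB fuB]; split=> //; exact: (frechet_urysohn_quotient (R := R)).
have iv_ii : is_stone_cech B /\ quotient_mapping (sigLR [fun phi in D]) ->
    closed (pullback R phi : set (tau_p R D)).
  by move=> [scB qB]; exact: quotient_closed_pullback.
have ii_i : closed (pullback R phi : set (tau_p R D)) -> induced_by_skeleton R B.
  exact: closed_pullback_induced.
tfae.
- by move=> /i_iii/iii_iv/iv_ii.
- by move=> /ii_i/i_iii.
- exact: iii_iv.
- by move=> /iv_ii/ii_i.
Qed.
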